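(* Let $d\ge 1$ be an integer and let $f \in C([0,1]^d)$. Then there exist affine maps $\mathcal{A}_i,\ \mathcal{A}_i^{\mathrm{out}} \in \mathsf{Aff}_{\le 5d+1}$ for all $i\in\mathbb{N}^+=\{1,2,3,\dots\}$ (with compatible dimensions, so that each expression below is a well-defined real-valued function on $[0,1]^d$) such that the sequence of functions $$\Phi_k := \sum_{\ell=1}^k \mathcal{A}_\ell^{\mathrm{out}} \circ (\mathrm{ReLU}\circ \mathcal{A}_\ell)\circ(\mathrm{ReLU}\circ \mathcal{A}_{\ell-1})\circ\cdots\circ(\mathrm{ReLU}\circ\mathcal{A}_1), \qquad k\in\mathbb{N}^+,$$ generates residuals $R_k := f-\Phi_k$ on $[0,1]^d$ with the following properties: (i) For every $\boldsymbol{x}\in[0,1]^d$, the sequence $(|R_k(\boldsymbol{x})|)_{k\ge1}$ is nonincreasing and converges to $0$; and the sequence $(\|R_k\|_{L^\infty([0,1]^d)})_{k\ge 1}$ is nonincreasing and converges to $0$ as $k\to\infty$. (ii) For every $p\in[1,\infty)$, $\|R_k\|_{L^p([0,1]^d)}$ decreases to $0$ as $k\to\infty$, strictly until it reaches zero; that is, $\|R_k\|_{L^p([0,1]^d)}\to 0$ and for every $k\in\mathbb{N}^+$, either $R_{k+1}\equiv R_k\equiv 0$ on $[0,1]^d$ or $\|R_{k+1}\|_{L^p([0,1]^d)}<\|R_k\|_{L^p([0,1]^d)}$.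
   Context: $C([0,1]^d)$ is the space of real-valued continuous functions on $[0,1]^d$. $\mathrm{ReLU}(t)=\max\{t,0\}$, applied componentwise to vectors. $\mathsf{Aff}(k,m)$ denotes the set of affine maps $\mathbb{R}^k\to\mathbb{R}^m$, $\boldsymbol{x}\mapsto \boldsymbol{W}\boldsymbol{x}+\boldsymbol{b}$ with $\boldsymbol{W}\in\mathbb{R}^{m\times k}$, $\boldsymbol{b}\in\mathbb{R}^m$, and $\mathsf{Aff}_{\le n}:=\bigcup_{1\le k\le n}\bigcup_{1\le m\le n}\mathsf{Aff}(k,m)$. The same maps $\mathcal{A}_i$ are shared by all terms and all $k$. *)

(* Defs.v *)
From HB Require Import structures.
From mathcomp Require Import all_boot all_order all_algebra.
From mathcomp Require Import all_classical all_reals all_analysis.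

Set Implicit Arguments.
Unset Strict Implicit.
Unset Printing Implicit Defensive.

Import Order.TTheory GRing.Theory Num.Theory.
Import numFieldNormedType.Exports.

Local Open Scope classical_set_scope.
Local Open Scope ring_scope.

(* Powers of a sigma-finite measure. Points of T^n are n-tuples, which carry the
   product sigma-algebra; the binary product measure is iterated and transported
   along (x, t) |-> x :: t, starting from the unit mass on the one-point space
   T^0. *)
Section tuple_product_measure.
Context d (T : measurableType d) (R : realType).
Variable m : {sigma_finite_measure set T -> \bar R}.

Section cons_measure.
Variables (n : nat) (mu : {sigma_finite_measure set (n.-tuple T) -> \bar R}).

Definition cons_pair (p : T * n.-tuple T) : n.+1.-tuple T :=
  [the n.+1.-tuple T of p.1 :: p.2].

Lemma measurable_cons_pair : measurable_fun [set: T * n.-tuple T] cons_pair.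
Proof. exact: measurable_cons. Qed.

Definition cons_measure : set (n.+1.-tuple T) -> \bar R :=
  pushforward (m \x mu)%E cons_pair.

Let cons_measure0 : cons_measure set0 = 0%E.
Proof. by have mc := measurable_cons_pair; exact: measure0. Qed.

Let cons_measure_ge0 A : (0 <= cons_measure A)%E.
Proof. by have mc := measurable_cons_pair; exact: measure_ge0. Qed.

Let cons_measure_sigma_additive : semi_sigma_additive cons_measure.
Proof.
by have mc := measurable_cons_pair; exact: measure_semi_sigma_additive.
Qed.

HB.instance Definition _ := isMeasure.Build _ _ _ cons_measure
  cons_measure0 cons_measure_ge0 cons_measure_sigma_additive.

Lemma cons_measure_sigma_finite : sigma_finite setT cons_measure.
Proof.
have /sigma_finiteP[F [TF ndF Foo]] := sigma_finiteT m.
have /sigma_finiteP[G [TG ndG Goo]] := sigma_finiteT mu.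
pose uncons (t : n.+1.-tuple T) : T * n.-tuple T :=
  (thead t, [tuple of behead t]).
have consK : cancel cons_pair uncons.
  by case=> x t; congr pair; apply/val_inj.
have muncons : measurable_fun [set: n.+1.-tuple T] uncons.
  apply/measurable_fun_pairP; split; first exact: measurable_tnth.
  exact: measurable_behead.
exists (fun i => uncons @^-1` (F i `*` G i)).
  rewrite -preimage_bigcup (_ : \bigcup_i _ = setT) ?preimage_setT//.
  apply/seteqP; split=> // -[x t] _.
  have [i _ Fx] : (\bigcup_i F i) x by rewrite -TF.
  have [j _ Gt] : (\bigcup_i G i) t by rewrite -TG.
  exists (maxn i j) => //; split.
    by move: x Fx; exact/subsetPset/ndF/leq_maxl.
  by move: t Gt; exact/subsetPset/ndG/leq_maxr.
move=> i; have [mFi Fioo] := Foo i; have [mGi Gioo] := Goo i; split.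
  by rewrite -[_ @^-1` _]setTI; apply: muncons => //; exact: measurableX.
rewrite /cons_measure /pushforward.
have -> : cons_pair @^-1` (uncons @^-1` (F i `*` G i)) = F i `*` G i.
  have /funext unconsE : uncons \o cons_pair =1 id by exact: consK.
  by rewrite -comp_preimage unconsE preimage_id.
by rewrite product_measure1E// lte_mul_pinfty// ge0_fin_numE.
Qed.

HB.instance Definition _ := Measure_isSigmaFinite.Build _ _ _ cons_measure
  cons_measure_sigma_finite.

End cons_measure.

Fixpoint tuple_measure (n : nat) :
    {sigma_finite_measure set (n.-tuple T) -> \bar R} :=
  match n with
  | 0 => \d_([tuple] : 0.-tuple T)
  | n'.+1 => cons_measure (tuple_measure n')
  end.

Lemma tuple_measure_box (n : nat) (A : 'I_n -> set T) :
  (forall i, measurable (A i)) ->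
  tuple_measure n [set t | forall i, A i (tnth t i)] =
  (\prod_(i < n) m (A i))%E.
Proof.
elim: n A => [|n IHn] A mA.
  by rewrite big_ord0 /= diracE mem_set//= => -[].
rewrite big_ord_recl -IHn// -product_measure1E//=; last first.
  rewrite (_ : mkset _ = \bigcap_(i in [set: 'I_n])
      ((@tnth n T ^~ i) @^-1` A (lift ord0 i))).
    apply: fin_bigcap_measurable => // i _.
    by rewrite -[_ @^-1` _]setTI; exact: measurable_tnth.
  by apply/seteqP; split=> t h i; [move=> _|]; exact: h.
rewrite /cons_measure /pushforward; congr product_measure1.
apply/seteqP; split=> -[x t] /= h.
  split; first by have := h ord0; rewrite tnth0.
  by move=> i; have := h (lift ord0 i); rewrite tnthS.
case: h => h0 h i.
by case: (unliftP ord0 i) => [j ->|->]; rewrite ?tnthS ?tnth0.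
Qed.

End tuple_product_measure.

Definition lebesgue_tuple (R : realType) (d : nat) :
    {sigma_finite_measure set (d.-tuple (measurableTypeR R)) -> \bar R} :=
  tuple_measure (@lebesgue_measure R) d.

Definition cube (R : realType) (d : nat) : set 'cV[R]_d :=
  [set x | forall i, 0 <= x i ord0 <= 1].

(* The L^p([0,1]^d) norm, 1 <= p <= +oo (the essential supremum for p = +oo).
   Extending g by 0 outside the cube does not change the norm over the cube. *)
Definition cube_Lnorm (R : realType) (d : nat) (p : \bar R)
    (g : 'cV[R]_d -> R) : \bar R :=
  Lnorm (lebesgue_tuple R d) p
    (fun t => ((g \_ (@cube R d)) (\col_i tnth t i))%:E).

Definition Aff (R : realType) (k m : nat) : set ('cV[R]_k -> 'cV[R]_m) :=
  [set A | exists (W : 'M[R]_(m, k)) (b : 'cV[R]_m),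
     forall x, A x = W *m x + b].

(* The maps 'cV_k -> 'cV_m that belong to the union Aff_{<= n}. *)
Definition Aff_le (R : realType) (n k m : nat) :
    set ('cV[R]_k -> 'cV[R]_m) :=
  [set A | [/\ (1 <= k <= n)%N, (1 <= m <= n)%N & Aff A]].

Definition relu (R : realType) (m : nat) (x : 'cV[R]_m) : 'cV[R]_m :=
  map_mx (fun t => Num.max t 0) x.

(* Layer 0 is the input; layer i + 1 has dimension w i. *)
Definition layer_dim (d : nat) (w : nat -> nat) (i : nat) : nat :=
  if i is j.+1 then w j else d.

(* Indices are shifted by one: the (i + 1)-st affine map, from layer i to layer
   i + 1, is A i, and its output map is Aout i. *)
Section network.
Variables (R : realType) (d : nat) (w : nat -> nat).
Variable A : forall i : nat,
  'cV[R]_(layer_dim d w i) -> 'cV[R]_(layer_dim d w i.+1).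
Variable Aout : forall i : nat, 'cV[R]_(layer_dim d w i.+1) -> 'cV[R]_1.

Fixpoint layer (n : nat) (x : 'cV[R]_d) : 'cV[R]_(layer_dim d w n) :=
  match n with
  | 0 => x
  | n'.+1 => relu (A (layer n' x))
  end.

Definition Phi (k : nat) (x : 'cV[R]_d) : R :=
  \sum_(l < k) Aout (layer l.+1 x) ord0 ord0.

Definition residual (f : 'cV[R]_d -> R) (k : nat) (x : 'cV[R]_d) : R :=
  f x - Phi k x.

End network.

(* Main.v *)
(* A pyramid x |-> c max(1 - s |x - a|_1, 0) is computed by two hidden layers: the
   first contains relu(x - a) and relu(a - x), whose difference recovers x - a and
   whose sum of coordinates is |x - a|_1.  Since x is recovered at each layer, a
   network of width 2d + 1 <= 5d + 1 can output an arbitrary sequence of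
   pyramids, one per layer (the first layer outputs 0).

   It remains to write f as a series of pyramids whose residuals decrease.  If
   |g| <= M on the cube, take a fine grid of mesh 1/N and, at each node a where
   |g(a)| >= 3M/4, a pyramid of radius 2d/N and height sg(g(a)) M/(4K), where
   K = (4d)^d bounds the number of pyramids that are nonzero at a given point.  At
   a point where some of them are nonzero, |g| > M/4 and g has the sign of each of
   them, so subtracting any subfamily lowers |g| by the sum of the absolute values;
   subtracting all of them brings the bound M down to (1 - 1/(8K)) M.  As K
   depends on d only, iterating gives uniform convergence to 0.  Each step lowers
   |g| strictly at a point of the cube, hence by continuity on a box of positive
   measure, so that the L^p norms decrease strictly. *)

Require Import Defs.
From mathcomp Require Import all_boot all_order all_algebra.
From mathcomp Require Import all_classical all_reals all_analysis.
From mathcomp Require Import measurable_realfun ess_sup_inf ring lra.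

Set Implicit Arguments.
Unset Strict Implicit.
Unset Printing Implicit Defensive.

Import Order.TTheory GRing.Theory Num.Theory.
Import numFieldNormedType.Exports.

Local Open Scope classical_set_scope.
Local Open Scope ring_scope.

(** * Uniform continuity and tents *)

Section uniform_continuity.
Variables (R : realType) (d : nat).
Implicit Types (g h : 'cV[R]_d -> R) (x y a : 'cV[R]_d).

(** The transpose is continuous and carries a product of segments, compact in row vectors by
    [rV_compact], onto the cube. *)
Lemma compact_cube : compact (@cube R d).
Proof.
have trC : continuous (trmx : 'rV[R]_d -> 'cV[R]_d).
  move=> x A /nbhs_ballP[e /= e0 eA]; apply/nbhs_ballP; exists e => //= y [_ xy].
  by apply: eA; split=> // i j; rewrite !mxE; exact: xy.
have cI (i : 'I_d) : compact `[0 : R, 1] by exact: segment_compact.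
have := continuous_compact (continuous_subspaceT trC) (rV_compact cI).
congr compact; apply/seteqP; split=> [_ [v + <-] i|x cx].
  by move=> /(_ i); rewrite /= in_itv/= mxE.
exists x^T; last exact: trmxK.
by move=> i; rewrite /= in_itv/= mxE; exact: cx.
Qed.

(** Distances are taken coordinate by coordinate, so that [r] compares directly with the mesh of a
    grid or the sides of a box. *)
Definition ucont g := forall e : R, 0 < e -> exists2 r : R, 0 < r &
  forall x y, cube x -> cube y -> (forall i, `|x i ord0 - y i ord0| < r) ->
  `|g x - g y| < e.

Lemma within_continuous_ball g x (e : R) : {within @cube R d, continuous g} ->
  cube x -> 0 < e -> exists2 r : R, 0 < r &
  forall y, cube y -> (forall i, `|x i ord0 - y i ord0| < r) ->
  `|g x - g y| < e.
Proof.
move=> /subspace_continuousP cg cx e0.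
have /cvg_ballP/(_ e e0) := cg x cx.
rewrite /= => /nbhs_ballP[r /= r0 xr].
exists r => // y cy xy; apply: (xr y) => //; split=> // i j.
by rewrite !ord1; exact: xy.
Qed.

(** Heine-Cantor: compactness, in its near-covering form, turns radii that work near each point into
    one that works on the whole cube. *)
Lemma within_continuous_ucont g : {within @cube R d, continuous g} -> ucont g.
Proof.
move=> cg e e0.
have /compact_near_coveringP/near_covering_withinP ncov := compact_cube.
pose P (r : R) (x : 'cV[R]_d) := forall y, cube y ->
  (forall i, `|x i ord0 - y i ord0| < r) -> `|g x - g y| < e.
suff /filter_ex[r [r0 rP]] : \forall r \near (0 : R)^'+,
    0 < r /\ @cube R d `<=` P r.
  by exists r => // x y cx; exact: rP.
near=> r; split=> //; near: r.
apply: (ncov R 0^'+ P) => x cx.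
have [r r0 xr] := within_continuous_ball cg cx (divr_gt0 e0 (ltr0n _ 2)).
(* If [x'] is within [r / 2] of [x] and [y] within [s < r / 2] of [x'], both are within [r] of [x],
   and the two errors [e / 2] add up. *)
exists (ball x (r / 2), [set s | 0 < s < r / 2]).
  split=> /=.
    by apply: nbhsx_ballx; rewrite divr_gt0.
  near=> s; apply/andP; split=> //; near: s; apply: nbhs_right_lt.
  by rewrite divr_gt0.
move=> [x' s] /= [[_ xx'] /andP[s0 sr]] cx' y cy x'y.
have gx' : `|g x - g x'| < e / 2.
  apply: xr => // i; apply: lt_le_trans (xx' i ord0) _; lra.
have gy : `|g x - g y| < e / 2.
  apply: xr => // i; rewrite (le_lt_trans (ler_distD (x' i ord0) _ _))//.
  by have := xx' i ord0; have := x'y i; rewrite /ball/=; lra.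
rewrite (le_lt_trans (ler_distD (g x) _ _))//.
by rewrite distrC; lra.
Unshelve. all: by end_near. Qed.

Lemma within_continuous_bounded g : {within @cube R d, continuous g} ->
  exists2 M, 0 < M & forall x, cube x -> `|g x| <= M.
Proof.
move=> cg.
have /compact_bounded[M [_ gM]] := continuous_compact cg compact_cube.
exists (`|M| + 1) => [|x cx]; first by rewrite ltr_wpDl.
by apply: gM; [rewrite (le_lt_trans (ler_norm M))// ltrDl|exists x].
Qed.

Lemma ucontB g h : ucont g -> ucont h -> ucont (fun x => g x - h x).
Proof.
move=> ug uh e e0.
have [r r0 gr] := ug _ (divr_gt0 e0 (ltr0n _ 2)).
have [s s0 hs] := uh _ (divr_gt0 e0 (ltr0n _ 2)).
exists (Num.min r s) => [|x y cx cy xy]; first by rewrite lt_min r0.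
have {}gr : `|g x - g y| < e / 2.
  by apply: gr => // i; have := xy i; rewrite lt_min => /andP[].
have {}hs : `|h x - h y| < e / 2.
  by apply: hs => // i; have := xy i; rewrite lt_min => /andP[].
move: gr hs; rewrite !ltr_norml => /andP[? ?] /andP[? ?]; apply/andP; split; lra.
Qed.

Lemma eq_ucont g h : g =1 h -> ucont g -> ucont h.
Proof. by move=> /funext ->. Qed.

Definition dist1 x a : R := \sum_i `|x i ord0 - a i ord0|.

Lemma dist1_ge0 x a : 0 <= dist1 x a.
Proof. exact: sumr_ge0. Qed.

Lemma dist1xx a : dist1 a a = 0.
Proof. by rewrite /dist1 big1// => i _; rewrite subrr normr0. Qed.

Lemma coord_dist1 x a i : `|x i ord0 - a i ord0| <= dist1 x a.
Proof. by rewrite /dist1 (bigD1 i)//= lerDl sumr_ge0. Qed.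

Definition tent s a x : R := Num.max (1 - s * dist1 x a) 0.

Lemma tent_ge0 s a x : 0 <= tent s a x.
Proof. by rewrite /tent le_max lexx orbT. Qed.

Lemma tent_le1 s a x : 0 <= s -> tent s a x <= 1.
Proof. by move=> s0; rewrite ge_max ler01 andbT gerBl mulr_ge0// dist1_ge0. Qed.

Lemma tent_center s a : tent s a a = 1.
Proof. by rewrite /tent dist1xx mulr0 subr0 max_l. Qed.

Lemma tent_supp s a x i : 0 < s -> tent s a x != 0 ->
  `|x i ord0 - a i ord0| < s^-1.
Proof.
move=> s0 tn0; rewrite (le_lt_trans (coord_dist1 _ _ _))// -[s^-1]mul1r.
rewrite ltr_pdivlMr// ltNge; apply: contra tn0 => ds.
by rewrite /tent max_r// subr_le0 mulrC.
Qed.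

(** The l1 distance to [a] is 1-Lipschitz for the l1 distance, and taking the maximum with 0 does
    not increase differences. *)
Lemma tent_lipschitz s a x y :
  `|tent s a x - tent s a y| <= `|s| * \sum_i `|x i ord0 - y i ord0|.
Proof.
have dxy : `|dist1 x a - dist1 y a| <= \sum_i `|x i ord0 - y i ord0|.
  rewrite /dist1 -sumrB (le_trans (ler_norm_sum _ _ _))// ler_sum// => i _.
  rewrite (le_trans (ler_dist_dist _ _))// opprB addrA subrK //.
have : `|(1 - s * dist1 x a) - (1 - s * dist1 y a)|
    <= `|s| * \sum_i `|x i ord0 - y i ord0|.
  rewrite opprB addrC addrA subrK -mulrBr normrM.
  by rewrite ler_wpM2l// distrC.
rewrite /tent; set u := 1 - _; set v := 1 - _; set w := `|s| * _.
have w0 : 0 <= w by rewrite mulr_ge0// sumr_ge0.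
rewrite !ler_norml !maxEge; case: ifPn; case: ifPn; rewrite -?ltNge; lra.
Qed.

Lemma ucont_tent c s a : ucont (fun x => c * tent s a x).
Proof.
move=> e e0.
(* The summand 1 keeps [L] positive when [c], [s] or [d] is 0. *)
pose L := `|c| * `|s| * d%:R + 1.
have L0 : 0 < L by rewrite ltr_wpDl// !mulr_ge0.
exists (e / L) => [|x y _ _ xy]; first exact: divr_gt0.
rewrite -mulrBr normrM.
apply: (@le_lt_trans _ _ (`|c| * (`|s| * \sum_(i < d) e / L))).
  rewrite ler_wpM2l// (le_trans (tent_lipschitz _ _ _ _))// ler_wpM2l//.
  by apply: ler_sum => i _; exact/ltW.
rewrite sumr_const card_ord -mulr_natl !mulrA -[ltLHS]mulrA.
rewrite mulrA ltr_pdivrMr// mulrC ltr_pM2l// /L ltrDl; exact: ltr01.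
Qed.

End uniform_continuity.

(** * Descent along pyramids on a grid *)

(** Such integers lie in an open interval of length [2 * D], so all of them are among the [2 * D]
    integers that start at the least one, [m]. *)
Lemma card_near_nat (R : realType) (N D : nat) (y : R) :
  (#|[pred n : 'I_N | (`|y - n%:R| < D%:R)%R]| <= 2 * D)%N.
Proof.
set A := [pred n | _].
have [n0 An0|A0] := pickP A; last by rewrite eq_card0.
have [m Am mA] : exists2 m, A m & forall n : 'I_N, A n -> (m <= n)%N.
  by case: (arg_minnP (fun n : 'I_N => n : nat) An0) => m; exists m.
rewrite cardE -(size_map val) -(size_iota m (2 * D)).
apply: uniq_leq_size; first by rewrite (map_inj_uniq val_inj) enum_uniq.
move=> _ /mapP[n + ->]; rewrite mem_enum mem_iota => An; rewrite mA//=.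
move: Am An; rewrite !inE !ltr_norml => /andP[? ?] /andP[? ?].
rewrite -(ltr_nat R) natrD natrM; lra.
Qed.

Lemma card_near_grid (R : realType) (d N D : nat) (y : 'I_d -> R) :
  (#|[pred n : {ffun 'I_d -> 'I_N} |
      [forall i, (`|y i - (n i)%:R| < D%:R)%R]]| <= (2 * D) ^ d)%N.
Proof.
pose A i := [pred n : 'I_N | `|y i - n%:R| < D%:R].
rewrite (@eq_card _ _ (family A)); last first.
  move=> n; apply/idP/idP => [/forallP h|/familyP h].
    by apply/familyP => i; exact: h.
  by apply/forallP => i; exact: h.
rewrite card_family foldrE big_map.
rewrite (@leq_trans (\prod_(i : 'I_d) (2 * D))%N)//.
  by rewrite big_enum/=; apply: leq_prod => i _; exact: card_near_nat.
by rewrite prod_nat_const card_ord.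
Qed.

Section descent.
Variables (R : realType) (d : nat).
Implicit Types (g h : 'cV[R]_d -> R) (x y a : 'cV[R]_d).

Definition pyramid : Type := (R * R * 'cV[R]_d)%type.
Implicit Types (b : pyramid) (E F : seq pyramid).

Definition pyramid_fun b x : R := b.1.1 * tent b.1.2 b.2 x.

Definition resid g E x : R := g x - \sum_(b <- E) pyramid_fun b x.

Lemma resid_nil g : resid g [::] = g.
Proof. by apply/funext => x; rewrite /resid big_nil subr0. Qed.

Lemma resid_cat g E F : resid g (E ++ F) = resid (resid g E) F.
Proof. by apply/funext => x; rewrite /resid big_cat/= opprD addrA. Qed.

Lemma resid_rcons g E b x : resid g (rcons E b) x = resid g E x - pyramid_fun b x.
Proof. by rewrite -cats1 resid_cat {1}/resid big_seq1. Qed.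

Lemma ucont_resid g E : ucont g -> ucont (resid g E).
Proof.
move=> ug; elim/last_ind: E => [|E b IH]; first by rewrite resid_nil.
apply: eq_ucont (fun x => esym (resid_rcons g E b x)) _.
by apply: ucontB => //; exact: ucont_tent.
Qed.

(** The last alternative covers a residual that already vanishes on the cube, where no strict
    decrease is possible. *)
Definition improves g h :=
  (forall x, cube x -> `|h x| <= `|g x|) /\
  ((exists2 x, cube x & `|h x| < `|g x|) \/
   (forall x, cube x -> h x = 0 /\ g x = 0)).

Definition descent g E := forall k, (k < size E)%N ->
  improves (resid g (take k E)) (resid g (take k.+1 E)).

Lemma descent_cat g E F :
  descent g E -> descent (resid g E) F -> descent g (E ++ F).
Proof.
move=> dE dF k; rewrite size_cat => kEF; rewrite !take_cat.
case: ltnP => [kE|Ek].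
  case: ltnP => [k1E|Ek1]; first exact: dE.
  (* At the junction, the step that adds the last pyramid of [E] is still a step of [E]. *)
  have kE1 : k.+1 = size E by apply/eqP; rewrite eqn_leq kE Ek1.
  by have := dE _ kE; rewrite kE1 take_size subnn take0 cats0.
rewrite ltnNge (leq_trans Ek)//= subSn// !resid_cat; apply: dF.
by rewrite ltn_subLR.
Qed.

Lemma descent_le g E k x : descent g E -> cube x ->
  `|resid g E x| <= `|resid g (take k E) x|.
Proof.
move=> dE cx.
have [Ek|kE] := leqP (size E) k; first by rewrite take_oversize.
have H m : (m <= size E)%N -> (k <= m)%N ->
    `|resid g (take m E) x| <= `|resid g (take k E) x|.
  elim: m => [|m IH] mE; first by rewrite leqn0 => /eqP ->.
  rewrite leq_eqVlt => /predU1P[->//|km].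
  by apply: le_trans (IH (ltnW mE) km); case: (dE _ mE) => + _; exact.
by rewrite -[in leLHS](take_size E); apply: H => //; exact: ltnW.
Qed.

(** * One stage: lowering a uniform bound by a factor that depends on d only *)

Section stage.
Hypothesis d0 : (0 < d)%N.
Variables (g : 'cV[R]_d -> R) (M : R).
Hypotheses (M0 : 0 < M) (gM : forall x, cube x -> `|g x| <= M).

Definition overlap : R := ((4 * d) ^ d)%:R.

Lemma overlap_ge1 : 1 <= overlap.
Proof. by rewrite ler1n expn_gt0 muln_gt0 d0. Qed.

Variables (N : nat) (N0 : (0 < N)%N).
Hypothesis gN : forall x y, cube x -> cube y ->
  (forall i, `|x i ord0 - y i ord0| < (2 * d)%:R / N%:R) ->
  `|g x - g y| < M / 8.

Local Notation index := {ffun 'I_d -> 'I_N.+1}.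
Local Notation height := (M / (4 * overlap)).

Definition node (n : index) : 'cV[R]_d := \col_i ((n i)%:R / N%:R).

(** The absolute value of the pyramid at a high node. The height makes at most [overlap] hills sum
    to at most M/4; the slope leaves a tent at least 1/2 at l1 distance d/N, the reach of rounding
    to the grid. *)
Definition hill (n : index) x : R :=
  height * tent (N%:R / (2 * d)%:R) (node n) x.

Definition node_pyramid (n : index) : pyramid :=
  (Num.sg (g (node n)) * height, N%:R / (2 * d)%:R, node n).

Definition high (n : index) := 3 / 4 * M <= `|g (node n)|.

Let overlap0 : 0 < overlap.
Proof. exact: lt_le_trans overlap_ge1. Qed.

Let height0 : 0 < height.
Proof. by rewrite divr_gt0// mulr_gt0. Qed.

Let NR0 : 0 < N%:R :> R.
Proof. by rewrite ltr0n. Qed.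

Let slope0 : 0 < N%:R / (2 * d)%:R :> R.
Proof. by rewrite divr_gt0// ltr0n muln_gt0 d0. Qed.

Lemma cube_node n : cube (node n).
Proof.
move=> i; rewrite mxE divr_ge0//= ler_pdivrMr// mul1r ler_nat.
by rewrite -ltnS ltn_ord.
Qed.

Lemma hill_ge0 n x : 0 <= hill n x.
Proof. by rewrite mulr_ge0 ?tent_ge0// ltW. Qed.

Lemma hill_near n x i : hill n x != 0 ->
  `|x i ord0 - node n i ord0| < (2 * d)%:R / N%:R.
Proof.
rewrite mulf_eq0 negb_or => /andP[_].
by move=> /(tent_supp i slope0); rewrite invf_div.
Qed.

(* A hill is nonzero at x only if the node is close to x in each coordinate, and
   there are at most (4d)^d such nodes. *)
Lemma sum_hill_le (s : seq index) x : uniq s -> \sum_(n <- s) hill n x <= M / 4.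
Proof.
move=> us.
pose A := [pred n : index |
  [forall i, `|N%:R * x i ord0 - (n i)%:R| < (2 * d)%:R]].
have hillA n : hill n x <= (n \in A)%:R * height.
  have [nA|nA] := boolP (n \in A).
    by rewrite mul1r ler_piMr ?tent_le1// ltW.
  rewrite mul0r; have [->//|/hill_near xn] := eqVneq (hill n x) 0.
  move: nA; rewrite inE => /forallP[] i.
  have := xn i; rewrite ltr_pdivlMr// mxE -{2}(gtr0_norm NR0) -normrM.
  by rewrite mulrBl divfK ?gt_eqF// mulrC.
apply: (@le_trans _ _ (\sum_(n <- s) (n \in A)%:R * height)).
  exact: ler_sum.
rewrite -mulr_suml -natr_sum.
have card_sA : (\sum_(n <- s) (n \in A) <= (4 * d) ^ d)%N.
  have -> : (4 * d = 2 * (2 * d))%N by rewrite mulnA.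
  apply: leq_trans (card_near_grid N.+1 (2 * d) (fun i => N%:R * x i ord0)).
  rewrite -/A -big_mkcond sum1_count -size_filter cardE.
  apply: uniq_leq_size; first exact: filter_uniq.
  by move=> n; rewrite mem_filter mem_enum => /andP[].
apply: (@le_trans _ _ (overlap * height)).
  by apply: ler_wpM2r; [exact: ltW|rewrite ler_nat].
suff -> : overlap * height = M / 4 by [].
by field; rewrite gt_eqF.
Qed.

(** If some hill of [s] is nonzero at [x], then |g x| > 3M/4 - M/8 > M/4, which bounds the sum;
    otherwise the sum is 0. *)
Lemma sum_hill_le_norm (s : seq index) x : cube x -> uniq s ->
  {in s, forall n, high n} -> \sum_(n <- s) hill n x <= `|g x|.
Proof.
move=> cx us hs.
have [/allP h0|/allPn[n ns hn]] := boolP (all (fun n => hill n x == 0) s).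
  by rewrite big_seq big1// => n /h0/eqP.
apply: le_trans (sum_hill_le _ us) _.
have := gN cx (cube_node n) (fun i => hill_near i hn).
have := hs _ ns; rewrite /high => gn.
have := lerB_dist (g (node n)) (g x); have := M0.
rewrite distrC; lra.
Qed.

(** On the support of its hill [g] varies by less than M/8, while |g| is at least 3M/4 at the node:
    the sign of [g] is constant there. *)
Lemma node_pyramidE n x : cube x -> high n ->
  pyramid_fun (node_pyramid n) x = Num.sg (g x) * hill n x.
Proof.
move=> cx hn; rewrite /pyramid_fun /= -mulrA -/(hill n x).
have [->|h0] := eqVneq (hill n x) 0; first by rewrite !mulr0.
have := gN cx (cube_node n) (fun i => hill_near i h0).
move: hn; rewrite /high ltr_norml => hn /andP[gl gr]; congr (_ * _).
have M_gt0 := M0; move: hn; rewrite ler_normr => /orP[ga|ga].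
  rewrite !gtr0_sg//; lra.
rewrite !ltr0_sg//; lra.
Qed.

(** All the pyramids have the sign of [g x] and their total does not exceed |g x|, so the
    subtraction never overshoots 0. *)
Lemma resid_nodes (s : seq index) x : cube x -> uniq s ->
  {in s, forall n, high n} ->
  `|resid g (map node_pyramid s) x| = `|g x| - \sum_(n <- s) hill n x.
Proof.
move=> cx us hs; have Tg := sum_hill_le_norm cx us hs.
rewrite /resid big_map (eq_big_seq (fun n => Num.sg (g x) * hill n x)); last first.
  by move=> n ns; rewrite node_pyramidE//; exact: hs.
rewrite -mulr_sumr {1}[g x]numEsg -mulrBr normrM.
rewrite [X in _ * X]ger0_norm ?subr_ge0// normr_sg.
(* At a zero of [g] the left side is 0, and the sum of hills is squeezed between 0 and |g x| = 0. *)
have [gx0|_] := eqVneq (g x) 0; last by rewrite mul1r.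
rewrite mul0r; apply/eqP; rewrite eq_le subr_ge0 Tg.
by rewrite gx0 normr0 sub0r oppr_le0 sumr_ge0// => n _; exact: hill_ge0.
Qed.

Definition stage := [seq node_pyramid n | n <- enum [pred n | high n]].

Lemma descent_stage : descent g stage.
Proof.
move=> k; rewrite size_map => ks.
set s := enum _ in ks.
have us : uniq s by exact: enum_uniq.
have hs : {in s, forall n, high n} by move=> n; rewrite mem_enum.
(* [n0] serves as the default value of [nth]. *)
have [n0 _] : exists n, n \in s.
  by move: ks; case: (s) => // n ? _; exists n; exact: mem_head.
rewrite /stage -/s -!map_take.
have resE m x : cube x -> `|resid g (map node_pyramid (take m s)) x| =
    `|g x| - \sum_(n <- take m s) hill n x.
  move=> cx; apply: resid_nodes => //; first exact: take_uniq.
  by move=> n /mem_take; exact: hs.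
have sumE x : \sum_(n <- take k.+1 s) hill n x =
    \sum_(n <- take k s) hill n x + hill (nth n0 s k) x.
  by rewrite (take_nth n0)// -cats1 big_cat/= big_seq1.
split=> [x cx|]; first by rewrite !resE// sumE lerD2l lerN2 lerDl hill_ge0.
left; exists (node (nth n0 s k)); first exact: cube_node.
rewrite !resE; try exact: cube_node.
by rewrite sumE ltrD2l ltrN2 ltrDl /hill tent_center mulr1 height0.
Qed.

(** If |g x| is at most 7M/8, the bound holds already before the stage. Otherwise the node obtained
    by rounding [x] down is high, since 7/8 - 1/8 = 3/4, and its hill alone removes half of the
    height, which is M/(8 [overlap]). *)
Lemma stage_bound x : cube x ->
  `|resid g stage x| <= (1 - (8 * overlap)^-1) * M.
Proof.
move=> cx; rewrite resid_nodes//; first 1 last.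
- exact: enum_uniq.
- by move=> n; rewrite mem_enum.
have overlap8 : (8 * overlap)^-1 <= 8^-1.
  by rewrite lef_pV2 ?posrE ?mulr_gt0// ler_peMr// overlap_ge1.
have [gx|gx] := lerP (`|g x|) (7 / 8 * M).
  apply: (@le_trans _ _ `|g x|).
    by rewrite gerBl sumr_ge0// => n _; exact: hill_ge0.
  apply: le_trans gx _; apply: ler_wpM2r; [exact: ltW|lra].
(* A coordinate equal to 1 is rounded to N, whence the N + 1 indices per axis. *)
have xN i : (Num.trunc (N%:R * x i ord0) < N.+1)%N.
  have /andP[xi0 xi1] := cx i.
  have Nx0 : 0 <= N%:R * x i ord0 by rewrite mulr_ge0.
  rewrite ltnS -(ler_nat R) (@le_trans _ _ (N%:R * x i ord0)) ?truncn_le//.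
  by rewrite ler_piMr.
pose n : index := [ffun i => Ordinal (xN i)].
have xn i : `|x i ord0 - node n i ord0| <= N%:R^-1.
  have /andP[xi0 xi1] := cx i.
  have /truncn_itv/andP[lo hi] : 0 <= N%:R * x i ord0 by rewrite mulr_ge0.
  rewrite mxE ffunE /= -(ler_pM2l NR0) divff ?gt_eqF//.
  rewrite -{1}(gtr0_norm NR0) -normrM mulrBr mulrCA divff ?gt_eqF// mulr1.
  by rewrite ger0_norm ?subr_ge0// lerBlDr nat1r ltW.
have xn' i : `|x i ord0 - node n i ord0| < (2 * d)%:R / N%:R.
  rewrite (le_lt_trans (xn i))// ltr_pdivlMr// mulVf ?gt_eqF//.
  by rewrite ltr1n mul2n -addnn -ltnS ltnS (@leq_add 1 1).
have hn : high n.
  have := gN cx (cube_node n) xn'; have := M0; have := lerB_dist (g x) (g (node n)).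
  rewrite /high; lra.
have tn : 1 / 2 <= tent (N%:R / (2 * d)%:R) (node n) x.
  rewrite /tent le_max; apply/orP; left.
  have : dist1 x (node n) <= d%:R / N%:R.
    rewrite (le_trans (ler_sum _ (fun i _ => xn i)))//.
    by rewrite sumr_const card_ord -[leLHS]mulr_natl.
  move=> /(ler_wpM2l (ltW slope0)).
  have dR0 : d%:R != 0 :> R by rewrite pnatr_eq0 -lt0n.
  have -> : N%:R / (2 * d)%:R * (d%:R / N%:R) = 1 / 2 :> R.
    by rewrite natrM; field; rewrite dR0 gt_eqF.
  by move=> ?; lra.
have hT : height / 2 <= \sum_(n <- enum [pred n | high n]) hill n x.
  rewrite (bigD1_seq n)/= ?enum_uniq ?mem_enum//.
  rewrite -[leLHS]addr0 lerD//; last by rewrite sumr_ge0// => ? _; exact: hill_ge0.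
  by have := ler_wpM2l (ltW height0) tn; rewrite /hill; lra.
have <- : M - height / 2 = (1 - (8 * overlap)^-1) * M.
  by field; rewrite gt_eqF.
by rewrite lerB// gM.
Qed.

End stage.
End descent.

(** * Iterated stages and the infinite sequence of pyramids *)

Section improving_sequence.
Variables (R : realType) (d : nat).
Implicit Types (f g : 'cV[R]_d -> R) (E F : seq (pyramid R d)).

Lemma exists_stage g (M : R) : (0 < d)%N -> ucont g -> 0 < M ->
  (forall x, cube x -> `|g x| <= M) -> exists E, descent g E /\
  forall x, cube x -> `|resid g E x| <= (1 - (8 * overlap R d)^-1) * M.
Proof.
move=> d0 ug M0 gM.
have M80 : 0 < M / 8 by rewrite divr_gt0.
have [r r0 gr] := ug _ M80.
(* This [N] makes 2d/N at most [r]. *)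
pose N := (Num.trunc ((2 * d)%:R / r)).+1.
have N0 : (0 < N)%N by [].
have gN x y : cube x -> cube y ->
    (forall i, `|x i ord0 - y i ord0| < (2 * d)%:R / N%:R) ->
    `|g x - g y| < M / 8.
  move=> cx cy xy; apply: gr => // i; apply: lt_le_trans (xy i) _.
  rewrite ler_pdivrMr ?ltr0n// mulrC -ler_pdivrMr//.
  by rewrite ltW// truncnS_gt.
exists (stage g M N); split; first exact: descent_stage.
exact: stage_bound.
Qed.

(** The grid changes from stage to stage with the residual, but the factor [q] does not, so n stages
    bring the bound down to q^n M. *)
Lemma exists_descent g (M e : R) : (0 < d)%N -> ucont g -> 0 < M ->
  (forall x, cube x -> `|g x| <= M) -> 0 < e ->
  exists E, descent g E /\ forall x, cube x -> `|resid g E x| <= e.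
Proof.
move=> d0 ug M0 gM e0; pose q := 1 - (8 * overlap R d)^-1.
have o1 := overlap_ge1 R d0.
have o0 : 0 < 8 * overlap R d by lra.
have q1 : q < 1 by rewrite /q ltrBlDr ltrDl invr_gt0.
have q0 : 0 < q.
  by rewrite subr_gt0 invf_lt1//; lra.
have iter n : exists E, descent g E /\
    forall x, cube x -> `|resid g E x| <= q ^+ n * M.
  elim: n => [|n [E [dE EM]]].
    exists [::]; split=> // x cx; rewrite resid_nil mul1r; exact: gM.
  have [|F [dF FM]] := exists_stage d0 (ucont_resid E ug) _ EM.
    by rewrite mulr_gt0// exprn_gt0.
  exists (E ++ F); split; first exact: descent_cat.
  by move=> x cx; rewrite resid_cat exprS -mulrA; exact: FM.
have /cvgrPdist_lt/(_ (e / M)) qn0 : (q ^+ n @[n --> \oo] --> 0).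
  by apply: cvg_expr; rewrite gtr0_norm.
have [n _ /(_ n (leqnn n))] := qn0 (divr_gt0 e0 M0).
rewrite sub0r normrN gtr0_norm ?exprn_gt0// ltr_pdivlMr// => qe.
have [E [dE EM]] := iter n; exists E; split=> // x cx.
exact: le_trans (EM _ cx) (ltW qe).
Qed.

(* When g is not identically 0, a target bound smaller than some |g x| forces the
   list to be nonempty. *)
Lemma exists_nonempty_descent g (M e : R) : (0 < d)%N -> ucont g -> 0 < M ->
  (forall x, cube x -> `|g x| <= M) -> 0 < e ->
  exists E, [/\ (0 < size E)%N, descent g E &
                forall x, cube x -> `|resid g E x| <= e].
Proof.
move=> d0 ug M0 gM e0.
have [g0|/existsNP[x /not_implyP[cx /eqP gx]]] :=
    pselect (forall x, cube x -> g x = 0).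
  have zE x : resid g [:: (0, 0, 0)] x = g x.
    by rewrite /resid big_seq1 /pyramid_fun /= mul0r subr0.
  (* For [g] zero on the cube, a zero pyramid makes the list nonempty and satisfies the last
     alternative of [improves]. *)
  exists [:: (0, 0, 0)]; split=> //= [|x cx]; last first.
    by rewrite zE g0// normr0 ltW.
  case=> // _; rewrite /= resid_nil; split=> [x cx|]; first by rewrite zE.
  by right=> x cx; rewrite zE g0.
have gx2 : 0 < `|g x| / 2 by rewrite divr_gt0// normr_gt0.
have [|E [dE Ee]] := exists_descent (e := Num.min e (`|g x| / 2)) d0 ug M0 gM.
  by rewrite lt_min e0.
exists E; split=> //; last first.
  by move=> y cy; have := Ee _ cy; rewrite le_min => /andP[].
case: E dE Ee => // _ /(_ x cx); rewrite resid_nil le_min => /andP[_]; lra.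
Qed.

(** Lists with residual bounds 1/(n+1) are built, each extending the previous one by a nonempty
    block; they are prefixes of a single infinite sequence. *)
Lemma exists_improving_pyramids f (M : R) : (0 < d)%N -> ucont f -> 0 < M ->
  (forall x, cube x -> `|f x| <= M) -> exists b : nat -> pyramid R d,
  (forall k, improves (resid f (mkseq b k)) (resid f (mkseq b k.+1))) /\
  (forall e : R, 0 < e -> exists k, forall x, cube x ->
     `|resid f (mkseq b k) x| <= e).
Proof.
move=> d0 uf M0 fM.
(* The extension is chosen for every pair (n, E), with [descent] as a premise, so that plain
   recursion can define [L] before [descent] is proved for it. *)
have /choice[F HF] (nE : nat * seq (pyramid R d)) : exists F, descent f nE.2 ->
    [/\ (0 < size F)%N, descent f (nE.2 ++ F) &
        forall x, cube x -> `|resid f (nE.2 ++ F) x| <= nE.1.+1%:R^-1].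
  case: nE => n E /=.
  have [dE|ndE] := pselect (descent f E); last by exists [::].
  have EM x : cube x -> `|resid f E x| <= M.
    move=> cx; apply: le_trans (descent_le 0 dE cx) _.
    by rewrite take0 resid_nil; exact: fM.
  have e0 : 0 < n.+1%:R^-1 :> R by rewrite invr_gt0.
  have [F [F0 dF Fe]] := exists_nonempty_descent d0 (ucont_resid E uf) M0 EM e0.
  exists F => _; split=> //; first exact: descent_cat.
  by move=> x cx; rewrite resid_cat; exact: Fe.
pose L := nat_rect (fun=> seq (pyramid R d)) [::] (fun n E => E ++ F (n, E)).
have dL n : descent f (L n) by elim: n => //= n /(HF (n, _))[].
have LS n := HF (n, L n) (dL n).
have sizeL n : (n <= size (L n))%N.
  elim: n => //= n IH; rewrite size_cat -addn1 leq_add//.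
  by have [] := LS n.
have takeL m n : (m <= n)%N -> take (size (L m)) (L n) = L m.
  elim: n => [|n IH]; first by rewrite leqn0 => /eqP ->.
  rewrite leq_eqVlt => /predU1P[->|]; first by rewrite take_size.
  rewrite ltnS => mn; rewrite /= take_cat; case: ltnP => [_|]; first exact: IH.
  move=> nm; have <- : L n = L m by rewrite -(IH mn) take_oversize.
  by rewrite subnn take0 cats0.
(* [L k.+1] has at least k + 1 entries, so the default is never read; by [takeL], any other long
   enough [L n] has the same entry. *)
pose b k := nth (0, 0, 0) (L k.+1) k.
have mkseqb k n : (k <= size (L n))%N -> mkseq b k = take k (L n).
  move=> kn; apply: (@eq_from_nth _ (0, 0, 0)).
    by rewrite size_mkseq size_takel.
  move=> i; rewrite size_mkseq => ik; rewrite nth_mkseq// nth_take//.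
  have iL : (i < size (L i.+1))%N by exact: sizeL.
  have [le|/ltnW le] := leqP i.+1 n.
    by rewrite /b -(takeL _ _ le) nth_take.
  by rewrite /b -[in RHS](takeL _ _ le) nth_take// (leq_trans ik).
exists b; split=> [k|e e0].
  rewrite (mkseqb k k.+1) ?(leq_trans _ (sizeL k.+1))//.
  by rewrite (mkseqb k.+1 k.+1)//; exact/dL/sizeL.
pose n := Num.trunc e^-1.
exists (size (L n.+1)) => x cx; rewrite (mkseqb _ n.+1)// take_size.
have [_ _ /(_ x cx)/le_trans] := LS n; apply.
by rewrite -[leRHS]invrK lef_pV2 ?posrE ?invr_gt0// ltW// truncnS_gt.
Qed.

End improving_sequence.

(** * Networks computing pyramids *)

Section affine_maps.
Variable R : realType.

Lemma Aff_id n : Aff (fun x : 'cV[R]_n => x).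
Proof. by exists 1%:M, 0 => x; rewrite mul1mx addr0. Qed.

Lemma Aff_cst n m (c : 'cV[R]_m) : Aff (fun _ : 'cV[R]_n => c).
Proof. by exists 0, c => x; rewrite mul0mx add0r. Qed.

Lemma AffD n m (A B : 'cV[R]_n -> 'cV[R]_m) :
  Aff A -> Aff B -> Aff (fun x => A x + B x).
Proof.
move=> [W [a AE]] [V [b BE]]; exists (W + V), (a + b) => x.
by rewrite AE BE mulmxDl addrACA.
Qed.

Lemma Aff_mul n m p (W : 'M[R]_(p, m)) (A : 'cV[R]_n -> 'cV[R]_m) :
  Aff A -> Aff (fun x => W *m A x).
Proof.
move=> [V [a AE]]; exists (W *m V), (W *m a) => x.
by rewrite AE mulmxDr mulmxA.
Qed.

Lemma AffZ n m (c : R) (A : 'cV[R]_n -> 'cV[R]_m) :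
  Aff A -> Aff (fun x => c *: A x).
Proof.
move=> [W [a AE]]; exists (c *: W), (c *: a) => x.
by rewrite AE scalerDr scalemxAl.
Qed.

Lemma AffN n m (A : 'cV[R]_n -> 'cV[R]_m) : Aff A -> Aff (fun x => - A x).
Proof.
move=> [W [a AE]]; exists (- W), (- a) => x.
by rewrite AE opprD mulNmx.
Qed.

Lemma Aff_col_mx n m p (A : 'cV[R]_n -> 'cV[R]_m) (B : 'cV[R]_n -> 'cV[R]_p) :
  Aff A -> Aff B -> Aff (fun x => col_mx (A x) (B x)).
Proof.
move=> [W [a AE]] [V [b BE]]; exists (col_mx W V), (col_mx a b) => x.
by rewrite AE BE mul_col_mx add_col_mx.
Qed.

Lemma Aff_usubmx n m p (A : 'cV[R]_n -> 'cV[R]_(m + p)) :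
  Aff A -> Aff (fun x => usubmx (A x)).
Proof.
move=> [W [a AE]]; exists (usubmx W), (usubmx a) => x.
by rewrite AE linearD mul_usub_mx.
Qed.

Lemma Aff_dsubmx n m p (A : 'cV[R]_n -> 'cV[R]_(m + p)) :
  Aff A -> Aff (fun x => dsubmx (A x)).
Proof.
move=> [W [a AE]]; exists (dsubmx W), (dsubmx a) => x.
by rewrite AE linearD mul_dsub_mx.
Qed.

End affine_maps.

Section network_of_pyramids.
Variables (R : realType) (d : nat) (b : nat -> pyramid R d).

Definition net_width (_ : nat) := (d + d + 1)%N.

Definition split_shift (j : nat) (x : 'cV[R]_d) : 'cV[R]_(d + d) :=
  col_mx (x - (b j).2) (- (x - (b j).2)).

Definition unsplit_shift (j : nat) (y : 'cV[R]_(d + d)) : 'cV[R]_d :=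
  usubmx y - dsubmx y + (b j).2.

(** Layer [j.+1] recovers [x] from the shift by the apex of pyramid [j], shifts it by the next apex,
    and forms the tent of pyramid [j], which thus appears one layer after its shift. As [net_width]
    is constant, the codomain is convertible to the required layer type. *)
Definition net_hidden (i : nat) :
    'cV[R]_(layer_dim d net_width i) -> 'cV[R]_(d + d + 1) :=
  match i with
  | 0 => fun x => col_mx (split_shift 0 x) 0
  | j.+1 => fun y =>
      col_mx (split_shift j.+1 (unsplit_shift j (usubmx y)))
        (const_mx 1 - (b j).1.2 *: (const_mx 1 *m usubmx y))
  end.

(** The height may be negative, so it is applied here, after the last relu. *)
Definition net_out (i : nat) (y : 'cV[R]_(d + d + 1)) : 'cV[R]_1 :=
  if i is j.+1 then (b j).1.1 *: dsubmx y else 0.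

Lemma Aff_net_hidden i : Aff (@net_hidden i).
Proof.
have Aff_split j n (A : 'cV[R]_n -> 'cV[R]_d) :
    Aff A -> Aff (fun x => split_shift j (A x)).
  move=> AA; have As : Aff (fun x => A x - (b j).2).
    by apply: AffD => //; exact: Aff_cst.
  by apply: Aff_col_mx => //; exact: AffN.
case: i => [|j] /=.
  by apply: Aff_col_mx; [exact/Aff_split/Aff_id|exact: Aff_cst].
have Au : Aff (fun y : 'cV[R]_(d + d + 1) => usubmx y).
  exact/Aff_usubmx/Aff_id.
apply: Aff_col_mx; last first.
  by apply: AffD; [exact: Aff_cst|exact/AffN/AffZ/Aff_mul].
apply: Aff_split; apply: AffD; last exact: Aff_cst.
by apply: AffD; [exact: Aff_usubmx|exact/AffN/Aff_dsubmx].
Qed.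

Lemma Aff_net_out i : Aff (net_out i).
Proof.
case: i => [|j]; first exact: Aff_cst.
exact/AffZ/Aff_dsubmx/Aff_id.
Qed.

Lemma relu_col_mx m n (x : 'cV[R]_m) (y : 'cV[R]_n) :
  relu (col_mx x y) = col_mx (relu x) (relu y).
Proof. exact: map_col_mx. Qed.

(* relu(z) - relu(-z) = z, so that no neuron needs to store the input x. *)
Lemma unsplit_shiftK j x : unsplit_shift j (relu (split_shift j x)) = x.
Proof.
rewrite /unsplit_shift relu_col_mx col_mxKu col_mxKd.
apply/colP => i; rewrite !mxE; set t := x i ord0 - _.
have : Num.max t 0 - Num.max (- t) 0 = t by rewrite !maxEge; do 2 case: ifPn; lra.
by move=> ->; rewrite /t; lra.
Qed.

(** Coordinatewise, relu(t) + relu(-t) = |t|. *)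
Lemma sum_relu_split j x :
  const_mx 1 *m relu (split_shift j x) = (dist1 x (b j).2)%:M :> 'cV[R]_1.
Proof.
apply/colP => i; rewrite ord1 !mxE eqxx mulr1n big_split_ord/= -big_split/=.
apply: eq_bigr => k _; rewrite relu_col_mx col_mxEu col_mxEd !mxE !mul1r.
set t := x k ord0 - _; rewrite !maxEge; do 2 case: ifPn => *.
all: by [rewrite ger0_norm; lra|rewrite ler0_norm; lra].
Qed.

Definition net_pyramid (i : nat) (x : 'cV[R]_d) : 'cV[R]_1 :=
  if i is j.+1 then (tent (b j).1.2 (b j).2 x)%:M else 0.

Lemma layer_net i x :
  layer net_hidden i.+1 x = col_mx (relu (split_shift i x)) (net_pyramid i x).
Proof.
elim: i => [|i IH].
  rewrite /= relu_col_mx; congr col_mx.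
  by apply/colP => k; rewrite !mxE maxxx.
rewrite [LHS]/= -/(layer net_hidden i.+1 x) IH relu_col_mx col_mxKu.
rewrite unsplit_shiftK sum_relu_split; congr col_mx.
by apply/colP => k; rewrite !ord1 !mxE eqxx !mulr1n.
Qed.

(* The first layer outputs 0, whence the shift between k.+1 and k. *)
Lemma residual_net (f : 'cV[R]_d -> R) k :
  residual net_hidden net_out f k.+1 = resid f (mkseq b k).
Proof.
apply/funext => x; rewrite /residual /resid /Phi; congr (_ - _).
under eq_bigr => i _ do rewrite layer_net.
rewrite big_ord_recl /= mxE add0r /mkseq big_map -[X in iota 0 X]subn0 big_mkord.
by apply: eq_bigr => i _; rewrite col_mxKd !mxE eqxx mulr1n.
Qed.

End network_of_pyramids.

(** * Norms on the cube *)

Section cube_norms.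
Variables (R : realType) (d : nat).
Implicit Types (g h : 'cV[R]_d -> R).

Local Notation T := (d.-tuple (measurableTypeR R)).
Local Notation mu := (lebesgue_tuple R d).

Definition col_tuple (t : T) : 'cV[R]_d := \col_i tnth t i.

Definition tuple_cube : set T := col_tuple @^-1` @cube R d.

Definition box (l u : 'I_d -> R) : set T :=
  [set t | forall i, [set` `[l i, u i]] (tnth t i)].

Lemma measurable_box l u : measurable (box l u).
Proof.
rewrite (_ : box l u = \bigcap_(i in [set: 'I_d])
    ((@tnth d (measurableTypeR R) ^~ i) @^-1` [set` `[l i, u i]])).
  apply: fin_bigcap_measurable => // i _.
  rewrite -[_ @^-1` _]setTI; exact: measurable_tnth.
by apply/seteqP; split=> t h i; [move=> _|]; exact: h.
Qed.

Lemma box_measure l u : (forall i, l i < u i) ->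
  mu (box l u) = (\prod_i (u i - l i))%:E.
Proof.
move=> lu.
rewrite [LHS](tuple_measure_box (@lebesgue_measure R)
  (A := fun i => [set` `[l i, u i]])); last by move=> i; exact: measurable_itv.
rewrite -prodEFin; apply: eq_bigr => i _.
by rewrite [LHS](lebesgue_measure_itv `[l i, u i])/= lte_fin lu.
Qed.

Lemma tuple_cubeE : tuple_cube = box (fun=> 0) (fun=> 1).
Proof.
by apply/seteqP; split=> t h i; have := h i; rewrite mxE/= in_itv.
Qed.

Lemma measurable_tuple_cube : measurable tuple_cube.
Proof. by rewrite tuple_cubeE; exact: measurable_box. Qed.

Lemma tuple_cube_measure : mu tuple_cube = 1%E.
Proof. by rewrite tuple_cubeE box_measure// big1// => i _; rewrite subr0. Qed.

Definition cube_measurable g := measurable_fun tuple_cube (g \o col_tuple).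

Lemma cube_measurable_pyramid (b : pyramid R d) : cube_measurable (pyramid_fun b).
Proof.
rewrite /cube_measurable /comp /pyramid_fun /tent /dist1.
apply: measurable_funM; first exact: measurable_cst.
apply: measurable_maxr; last exact: measurable_cst.
apply: measurable_funB; first exact: measurable_cst.
apply: measurable_funM; first exact: measurable_cst.
apply: measurable_sum => i; apply: measurableT_comp; first exact: normr_measurable.
apply: measurable_funB; last exact: measurable_cst.
under eq_fun do rewrite mxE.
exact: (measurable_funTS (@measurable_tnth _ (measurableTypeR R) d i)).
Qed.

Lemma cube_measurable_resid g E : cube_measurable g -> cube_measurable (resid g E).
Proof.
move=> mg; apply: measurable_funB => //.
by apply: measurable_sum => b; exact: cube_measurable_pyramid.
Qed.

(* Gives the measurability of f for the product sigma-algebra without relating the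
   latter to the open sets of R^d. *)
Lemma cube_measurable_limit g (s : nat -> seq (pyramid R d)) :
  (forall x, cube x -> resid g (s k) x @[k --> \oo] --> 0) -> cube_measurable g.
Proof.
move=> s0; apply: (@measurable_fun_cvg _ _ _ _
    (fun k t => \sum_(b <- s k) pyramid_fun b (col_tuple t))).
  by move=> k; apply: measurable_sum => b; exact: cube_measurable_pyramid.
move=> t ct /=.
have sE : (fun k => \sum_(b <- s k) pyramid_fun b (col_tuple t)) =
    (fun k => g (col_tuple t) - resid g (s k) (col_tuple t)).
  by apply/funext => k; rewrite opprB addrC subrK.
rewrite sE -[X in _ --> X]subr0; apply: cvgB; first exact: cvg_cst.
exact: s0.
Qed.

Definition power_integrand (p : R) g (t : T) : \bar R :=
  (`|(g \_ (@cube R d)) (col_tuple t)| `^ p)%:E.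

Lemma cube_LnormE p g : cube_Lnorm p%:E g =
  ((\int[mu]_t power_integrand p g t) `^ p^-1)%E.
Proof. by rewrite /cube_Lnorm unlock. Qed.

Lemma measurable_power_integrand p g : cube_measurable g ->
  measurable_fun setT (power_integrand p g).
Proof.
move=> /(measurable_restrictT _ measurable_tuple_cube) mg.
apply/measurable_EFinP.
apply: (measurableT_comp (measurable_powR p)).
apply: (measurableT_comp (@normr_measurable R setT)).
exact: mg.
Qed.

Lemma power_integrand_ge0 p g t : (0 <= power_integrand p g t)%E.
Proof. by rewrite lee_fin powR_ge0. Qed.

Lemma power_integrand_le p g h t : 0 <= p ->
  (forall x, cube x -> `|g x| <= `|h x|) ->
  (power_integrand p g t <= power_integrand p h t)%E.
Proof.
move=> p0 gh; rewrite lee_fin ge0_ler_powR ?nnegrE//.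
by rewrite !patchE; case: ifPn => // /set_mem; exact: gh.
Qed.

(** Comparison with e^p times the indicator of the cube, which has measure 1. *)
Lemma integral_power_le p g (e : R) : 0 < p -> cube_measurable g -> 0 <= e ->
  (forall x, cube x -> `|g x| <= e) ->
  (\int[mu]_t power_integrand p g t <= (e `^ p)%:E)%E.
Proof.
move=> p0 mg e0 ge.
have -> : (e `^ p)%:E = (\int[mu]_t ((e `^ p)%:E * (\1_tuple_cube t)%:E))%E.
  rewrite ge0_integralZl_EFin ?powR_ge0//.
  - rewrite integral_indic//= ?setIT ?tuple_cube_measure ?mule1//.
    exact: measurable_tuple_cube.
  - by apply/measurable_EFinP; apply: measurable_indic; exact: measurable_tuple_cube.
apply: ge0_le_integral => //.
- by move=> t _; exact: power_integrand_ge0.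
- exact: measurable_power_integrand.
- apply/measurable_EFinP/measurable_funM; first exact: measurable_cst.
  by apply: measurable_indic; exact: measurable_tuple_cube.
- move=> t _; rewrite -EFinM lee_fin patchE indicE.
  have -> : (t \in tuple_cube) = (col_tuple t \in @cube R d) by [].
  (* Outside the cube the integrand is 0 to the power [p], which is 0 because [p] is positive. *)
  case: ifPn => [/set_mem ct|_]; last by rewrite normr0 powR0 ?gt_eqF// mulr0.
  by rewrite mulr1 ge0_ler_powR ?nnegrE ?ge// ltW.
Qed.

Lemma cube_Lnorm_le p g (e : R) : 0 < p -> cube_measurable g -> 0 <= e ->
  (forall x, cube x -> `|g x| <= e) -> (cube_Lnorm p%:E g <= e%:E)%E.
Proof.
move=> p0 mg e0 ge; rewrite cube_LnormE.
have -> : e%:E = ((e `^ p)%:E `^ p^-1)%E.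
  by rewrite poweR_EFin -powRrM mulfV ?gt_eqF// powRr1.
have int0 : (0 <= \int[mu]_t power_integrand p g t)%E.
  by apply: integral_ge0 => t _; exact: power_integrand_ge0.
apply: gt0_ler_poweR => //.
- by rewrite invr_ge0 ltW.
- by rewrite in_itv/= int0 leey.
- by rewrite in_itv/= lee_fin powR_ge0 leey.
- exact: integral_power_le.
Qed.

Lemma cube_Lnormy_le g (e : R) : 0 <= e ->
  (forall x, cube x -> `|g x| <= e) -> (cube_Lnorm +oo g <= e%:E)%E.
Proof.
move=> e0 ge; rewrite /cube_Lnorm unlock; case: ifPn => // _.
apply/ess_supP; apply: nearW => t /=; rewrite lee_fin patchE.
by case: ifPn => [/set_mem /ge//|_]; rewrite normr0.
Qed.

Lemma cube_Lnormy_mono g h : (forall x, cube x -> `|g x| <= `|h x|) ->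
  (cube_Lnorm +oo g <= cube_Lnorm +oo h)%E.
Proof.
move=> gh; rewrite /cube_Lnorm unlock; case: ifPn => // _.
apply: le_ess_sup; apply: nearW => t /=; rewrite lee_fin !patchE.
by case: ifPn => // /set_mem /gh.
Qed.

(** A box around [x] is cut down to the cube; its sides keep positive length because each coordinate
    of [x] lies in [0, 1]. *)
Lemma exists_box_near (x : 'cV[R]_d) (r : R) : cube x -> 0 < r -> exists l u,
  (forall i, l i < u i) /\ forall t, box l u t ->
  cube (col_tuple t) /\ forall i, `|x i ord0 - col_tuple t i ord0| < r.
Proof.
move=> cx r0.
exists (fun i => Num.max 0 (x i ord0 - r / 2)).
exists (fun i => Num.min 1 (x i ord0 + r / 2)).
split=> [i|t bt].
  have /andP[xi0 xi1] := cx i.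
  by rewrite lt_min !gt_max; apply/andP; split; apply/andP; split; lra.
split=> i.
  have := bt i; rewrite mxE/= in_itv/= ge_max le_min.
  by move=> /andP[/andP[-> _] /andP[-> _]].
have := bt i; rewrite mxE/= in_itv/= ge_max le_min => /andP[/andP[_ ?] /andP[_ ?]].
by rewrite ltr_norml; apply/andP; split; lra.
Qed.

(** Near [x] the gap between |g| and |h| persists on a box of positive measure, where |h|^p exceeds
    |g|^p by at least [c]; integrating gives a strict inequality. *)
Lemma cube_Lnorm_lt p g h (M : R) : 0 < p -> cube_measurable g ->
  cube_measurable h -> ucont g -> ucont h -> 0 < M ->
  (forall x, cube x -> `|h x| <= M) ->
  (forall x, cube x -> `|g x| <= `|h x|) ->
  (exists2 x, cube x & `|g x| < `|h x|) ->
  (cube_Lnorm p%:E g < cube_Lnorm p%:E h)%E.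
Proof.
move=> p0 mg mh ug uh M0 hM gh [x cx gx].
(* With a third of the gap, |g x| + m stays below |h x| - m. *)
pose m := (`|h x| - `|g x|) / 3.
have m0 : 0 < m by rewrite /m; lra.
have [r r0 gr] := ug _ m0; have [s s0 hs] := uh _ m0.
have rs0 : 0 < Num.min r s by rewrite lt_min r0.
have [l [u [lu xB]]] := exists_box_near cx rs0.
pose c := (`|h x| - m) `^ p - (`|g x| + m) `^ p.
have c0 : 0 < c.
  rewrite subr_gt0 gt0_ltr_powR ?nnegrE//.
  - by rewrite addr_ge0// ltW.
  - by rewrite subr_ge0 /m; have := normr_ge0 (g x); have := normr_ge0 (h x); lra.
  - by rewrite /m; lra.
have cB t : (power_integrand p g t + c%:E * (\1_(box l u) t)%:E <=
    power_integrand p h t)%E.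
  rewrite indicE; case: (boolP (t \in box l u)) => [/set_mem Bt|_]; last first.
    by rewrite mule0 adde0 power_integrand_le// ltW.
  have [ct xt] := xB _ Bt.
  have gt : `|g (col_tuple t)| <= `|g x| + m.
    have : `|g x - g (col_tuple t)| < m.
      by apply: gr => // i; have := xt i; rewrite lt_min => /andP[].
    by have := lerB_dist (g (col_tuple t)) (g x); rewrite distrC; lra.
  have ht : `|h x| - m <= `|h (col_tuple t)|.
    have : `|h x - h (col_tuple t)| < m.
      by apply: hs => // i; have := xt i; rewrite lt_min => /andP[].
    by have := lerB_dist (h x) (h (col_tuple t)); lra.
  rewrite mule1 /power_integrand -EFinD lee_fin !patchE mem_set// /c.
  have : `|g (col_tuple t)| `^ p <= (`|g x| + m) `^ p.
    by rewrite ge0_ler_powR ?nnegrE ?addr_ge0// ltW.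
  have : (`|h x| - m) `^ p <= `|h (col_tuple t)| `^ p.
    rewrite ge0_ler_powR ?nnegrE//; first exact: ltW.
    by rewrite /m; have := normr_ge0 (g x); have := normr_ge0 (h x); lra.
  lra.
have mB := measurable_box l u.
have intB : (\int[mu]_t (power_integrand p g t + c%:E * (\1_(box l u) t)%:E) =
    \int[mu]_t power_integrand p g t + (c * \prod_i (u i - l i))%:E)%E.
  rewrite ge0_integralD//.
  - congr (_ + _)%E; rewrite ge0_integralZl_EFin ?ltW//.
    + by rewrite integral_indic// setIT [X in (_ * X)%E]box_measure.
    + by apply/measurable_EFinP; exact: measurable_indic.
  - by move=> t _; exact: power_integrand_ge0.
  - exact: measurable_power_integrand.
  - by move=> t _; rewrite -EFinM lee_fin mulr_ge0// ltW.
  - apply/measurable_EFinP/measurable_funM; first exact: measurable_cst.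
    exact: measurable_indic.
have le_int : (\int[mu]_t power_integrand p g t + (c * \prod_i (u i - l i))%:E
    <= \int[mu]_t power_integrand p h t)%E.
  rewrite -intB; apply: ge0_le_integral => //.
  - move=> t _; rewrite adde_ge0 ?power_integrand_ge0// -EFinM lee_fin.
    by rewrite mulr_ge0// ltW.
  - apply: emeasurable_funD; first exact: measurable_power_integrand.
    apply/measurable_EFinP/measurable_funM; first exact: measurable_cst.
    exact: measurable_indic.
  - exact: measurable_power_integrand.
(* Both integrals are at most M^p, hence finite; otherwise adding a positive constant would not
   force strictness. *)
have := integral_power_le p0 mh (ltW M0) hM.
have := integral_power_le p0 mg (ltW M0) (fun x cx => le_trans (gh x cx) (hM x cx)).
rewrite !cube_LnormE.
have intg0 : (0 <= \int[mu]_t power_integrand p g t)%E.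
  by apply: integral_ge0 => t _; exact: power_integrand_ge0.
move: intg0 le_int; set I := integral _ _ _; set J := integral _ _ _.
move: I J => [I| |] [J| |]//; rewrite !lee_fin => I0 IJ _ _.
rewrite !poweR_EFin lte_fin.
have IltJ : I < J.
  move: IJ; apply: lt_le_trans; rewrite ltrDl mulr_gt0// prodr_gt0// => i _.
  by rewrite subr_gt0.
by rewrite gt0_ltr_powR ?invr_gt0// ?nnegrE// ltW// (le_lt_trans I0).
Qed.

End cube_norms.

(** * Convergence and decrease of the residuals of the network *)

Theorem theorem2p1 (R : realType) (d : nat) (hd : (1 <= d)%N)
    (f : 'cV[R]_d -> R) (hf : {within @cube R d, continuous f}) :
  exists (w : nat -> nat)
    (A : forall i : nat,
       'cV[R]_(layer_dim d w i) -> 'cV[R]_(layer_dim d w i.+1))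
    (Aout : forall i : nat, 'cV[R]_(layer_dim d w i.+1) -> 'cV[R]_1),
    (forall i : nat, Aff_le (5 * d + 1) (A i)) /\
    (forall i : nat, Aff_le (5 * d + 1) (Aout i)) /\
    let Res := residual A Aout f in
    (forall x : 'cV[R]_d, cube x ->
       (forall k : nat, (1 <= k)%N -> `|Res k.+1 x| <= `|Res k x|) /\
       (`|Res k x| @[k --> \oo] --> 0)) /\
    (forall k : nat, (1 <= k)%N ->
       (cube_Lnorm +oo (Res k.+1) <= cube_Lnorm +oo (Res k))%E) /\
    (cube_Lnorm +oo (Res k) @[k --> \oo] --> 0%E) /\
    (forall p : R, 1 <= p ->
       (cube_Lnorm p%:E (Res k) @[k --> \oo] --> 0%E) /\
       (forall k : nat, (1 <= k)%N ->
          (forall x : 'cV[R]_d, cube x -> Res k.+1 x = 0 /\ Res k x = 0) \/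
          (cube_Lnorm p%:E (Res k.+1) < cube_Lnorm p%:E (Res k))%E)).
Proof.
have d0 : (0 < d)%N := hd.
have uf := within_continuous_ucont hf.
have [M M0 fM] := within_continuous_bounded hf.
have [b [impr small]] := exists_improving_pyramids d0 uf M0 fM.
pose g k := resid f (mkseq b k).
have gle k x : cube x -> `|g k.+1 x| <= `|g k x|.
  by move=> cx; case: (impr k) => + _; exact.
have gmono k m x : cube x -> (k <= m)%N -> `|g m x| <= `|g k x|.
  move=> cx; elim: m => [|m IH]; first by rewrite leqn0 => /eqP ->.
  rewrite leq_eqVlt => /predU1P[->//|km].
  by rewrite (le_trans (gle _ _ cx))// IH.
have gM k x : cube x -> `|g k x| <= M.
  move=> cx; apply: le_trans (gmono 0 k x cx (leq0n k)) _.
  by rewrite /g resid_nil; exact: fM.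
have gsmall e : 0 < e -> \forall k \near \oo, forall x, cube x -> `|g k x| <= e.
  move=> /small[k0 gk0]; exists k0 => // k /= kk0 x cx.
  exact: le_trans (gmono _ _ _ cx kk0) (gk0 _ cx).
have g0 x : cube x -> g k x @[k --> \oo] --> 0.
  move=> cx; apply/cvgrPdist_le => e /gsmall; apply: filterS => k.
  by rewrite sub0r normrN; exact.
(* Measurability of [f] follows from the pointwise convergence just proved. *)
have mf : cube_measurable f by exact: (cube_measurable_limit g0).
have mg k : cube_measurable (g k) by exact: cube_measurable_resid.
have ug k : ucont (g k) by exact: ucont_resid.
(* One argument serves finite and infinite exponents: the norm is dominated by any uniform bound on
   the cube. *)
have Lnorm_cvg0 (p : \bar R) :
    (forall k e, 0 <= e -> (forall x, cube x -> `|g k x| <= e) ->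
      (cube_Lnorm p (g k) <= e%:E)%E) ->
    cube_Lnorm p (g k) @[k --> \oo] --> 0%E.
  move=> Lle; have L_fin : \forall k \near \oo, cube_Lnorm p (g k) \is a fin_num.
    apply: nearW => k; rewrite ge0_fin_numE ?Lnorm_ge0//.
    exact: le_lt_trans (Lle _ _ (ltW M0) (gM k)) (ltry _).
  apply/fine_cvgP; split=> //; apply/cvgrPdist_le => e e0.
  near=> k; rewrite sub0r normrN ger0_norm ?fine_ge0 ?Lnorm_ge0//.
  rewrite -lee_fin fineK; last by near: k.
  by apply: Lle; [exact: ltW|near: k; exact: gsmall].
have hw : (1 <= d + d + 1 <= 5 * d + 1)%N.
  rewrite addn1 /= -addn1 leq_add2r addnn -mul2n leq_mul2r; exact: orbT.
exists (net_width d), (net_hidden b), (net_out b); split; last split.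
- move=> i; split; [|exact: hw|exact: Aff_net_hidden].
  by case: i => [|i]; [rewrite /= d0 addn1 ltnW// ltnS leq_pmull|exact: hw].
- by move=> i; split; [exact: hw|rewrite addn1|exact: Aff_net_out].
have ResE k : residual (net_hidden b) (net_out b) f k.+1 = g k.
  exact: residual_net.
(* Limits transfer from [g] to the residuals, whose index is one higher; the threshold [N.+1]
   absorbs the shift. *)
have Res_shift (U : topologicalType) (F : ('cV[R]_d -> R) -> U) (y : U) :
    F (g k) @[k --> \oo] --> y ->
    F (residual (net_hidden b) (net_out b) f k) @[k --> \oo] --> y.
  move=> Fg A /Fg[N _ FN]; exists N.+1 => // -[//|k] kN.
  by rewrite /= ResE; exact: FN.
split=> /= [x cx|].
  split; first by case=> // k _; rewrite !ResE; exact: gle.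
  apply: (Res_shift _ (fun h => `|h x|)).
  by rewrite -(normr0 R); apply: cvg_norm; exact: g0.
split.
  by case=> // k _; rewrite !ResE; apply: cube_Lnormy_mono => x; exact: gle.
split.
  apply: (Res_shift _ (cube_Lnorm +oo)); apply: Lnorm_cvg0 => k e.
  exact: cube_Lnormy_le.
move=> p p1; have p0 : 0 < p by exact: lt_le_trans p1.
split.
  apply: (Res_shift _ (cube_Lnorm p%:E)); apply: Lnorm_cvg0 => k e.
  exact: cube_Lnorm_le.
(* The two alternatives of [improves] become strict decrease of the norm and vanishing of both
   residuals. *)
case=> // k _; rewrite !ResE; case: (impr k) => _ [lt_gk|]; last by left.
right; apply: (@cube_Lnorm_lt _ _ _ _ _ M) => //; first exact: gM.
by move=> x; exact: gle.
Unshelve. all: by end_near. Qed.
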